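(* There exist a compact metric space $X$ and a continuous map $f:X\to X$ such that $(X,f)$ has the shadowing property but $(\mathcal{M}(X),\hat f)$ does not have the shadowing property.
   Context: For a compact metric space $(X,d)$, $\mathcal{M}(X)$ is the space of all Borel probability measures on $X$ with the Prohorov metric $\mathcal{P}_d(\mu,\nu)=\inf\{\epsilon>0:\mu(A)\le\nu(A^\epsilon)+\epsilon \text{ and } \nu(A)\le\mu(A^\epsilon)+\epsilon \text{ for all Borel } A\subset X\}$, where $A^\epsilon=\{x\in X: d(x,A)<\epsilon\}$; its topology is the weak$^*$-topology and $\mathcal{M}(X)$ is a compact metric space. For continuous $f:X\to X$ the induced continuous map is $\hat f(\mu)(A)=\mu(f^{-1}(A))$. A $\delta$-pseudo orbit of $(X,f)$ is a finite or infinite sequence $\{x_0,x_1,\dots\}$ with $d(f(x_n),x_{n+1})<\delta$ for all $n=0,1,\dots$ for which $x_{n+1}$ is defined. $(X,f)$ has the shadowing property if for every $\varepsilon>0$ there is $\delta>0$ such that every $\delta$-pseudo orbit $\{x_0,x_1,\dots\}$ is $\varepsilon$-shadowed by some $y\in X$, i.e. $d(f^n(y),x_n)<\varepsilon$ for all indices $n$ of the pseudo orbit. For $\mathcal{M}(X)$ the metric used is $\mathcal{P}_d$. *)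

(* Defs.v *)
From HB Require Import structures.
From mathcomp Require Import all_boot all_order all_algebra.
From mathcomp Require Import all_classical all_reals all_analysis.

Set Implicit Arguments.
Unset Strict Implicit.
Unset Printing Implicit Defensive.

Import Order.TTheory GRing.Theory Num.Theory.

Local Open Scope classical_set_scope.
Local Open Scope ring_scope.

(* The base point only makes X nonempty, as [measurableType] requires; no
   definition below depends on it. *)
#[short(type="pointedMetricType")]
HB.structure Definition PointedMetric (R : numDomainType) :=
  {X of Pointed X & Metric R X}.

Section shadowing.
Context {R : realType} {T : Type}.
Variables (d : T -> T -> R) (f : T -> T).

(* A finite sequence x_0, ..., x_N is encoded by [Some N] together with a total
   function x whose values beyond N are ignored; [None] stands for an infinite
   sequence. *)
Definition is_index (len : option nat) (n : nat) : bool :=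
  if len is Some N then (n <= N)%N else true.

Definition pseudo_orbit (delta : R) (len : option nat) (x : nat -> T) : Prop :=
  forall n, is_index len n.+1 -> d (f (x n)) (x n.+1) < delta.

Definition shadows (eps : R) (y : T) (len : option nat) (x : nat -> T) : Prop :=
  forall n, is_index len n -> d (iter n f y) (x n) < eps.

Definition shadowing_property : Prop :=
  forall eps : R, 0 < eps -> exists2 delta : R, 0 < delta &
    forall (len : option nat) (x : nat -> T),
      pseudo_orbit delta len x -> exists y : T, shadows eps y len x.

End shadowing.

Definition borel {R : realType} (X : pointedMetricType R) :=
  g_sigma_algebraType (@open X).

(* A [probability] is a function on all subsets of X that is a probability
   measure on the Borel sets; its values elsewhere are arbitrary. The Prohorov
   distance reads only Borel sets, and the values of [induced_map f mu] on Borel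
   sets depend only on those of mu, so orbits and distances are unaffected. *)
Definition probM {R : realType} (X : pointedMetricType R) :=
  probability (borel X) R.

Section prohorov.
Context {R : realType} {X : pointedMetricType R}.

Definition dist_to_set (x : X) (A : set X) : \bar R :=
  ereal_inf [set (mdist x a)%:E | a in A].

Definition thickening (A : set X) (eps : R) : set X :=
  [set x | (dist_to_set x A < eps%:E)%E].

Definition prohorov_bound (mu nu : probM X) (eps : R) : Prop :=
  forall A : set (borel X), measurable A ->
    (mu A <= nu (thickening A eps) + eps%:E)%E /\
    (nu A <= mu (thickening A eps) + eps%:E)%E.

Definition prohorov (mu nu : probM X) : R :=
  inf [set eps : R | 0 < eps /\ prohorov_bound mu nu eps].

(* [inf] has a default value on sets without an infimum; this case does not
   occur here. *)
Lemma prohorov_has_inf (mu nu : probM X) :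
  has_inf [set eps : R | 0 < eps /\ prohorov_bound mu nu eps].
Proof.
split; last by exists 0 => e [/ltW].
exists 1; split=> // A mA; split.
- by rewrite (le_trans (probability_le1 mu mA))// leeDr.
- by rewrite (le_trans (probability_le1 nu mA))// leeDr.
Qed.

End prohorov.

Section induced_map.
Context {R : realType} {X : pointedMetricType R}.
Variables (f : X -> X) (cf : continuous f).

Lemma continuous_borel_measurable :
  measurable_fun [set: borel X] (f : borel X -> borel X).
Proof.
apply: (@measurability _ _ (borel X) (borel X) setT f (@open X)) => // _ [B oB <-].
rewrite setTI; apply: sub_sigma_algebra.
by move/continuousP : cf; exact.
Qed.

Definition induced_map (mu : probM X) : probM X :=
  distribution mu (mfun_Sub (mem_set continuous_borel_measurable)).

Lemma induced_mapE (mu : probM X) (A : set X) :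
  induced_map mu A = mu (f @^-1` A).
Proof. by []. Qed.

End induced_map.

(* Main.v *)
(** Take X with two points and f the identity. Points of X at distance less
    than 1 coincide, so pseudo-orbits in X are constant. But M(X) is isometric
    to [0, 1] with the identity map, where p = k / n for k <= n is a pseudo-orbit
    drifting from 0 to 1, which no fixed point shadows within 1/2. *)

Require Import Defs.
From HB Require Import structures.
From mathcomp Require Import all_boot all_order all_algebra.
From mathcomp Require Import all_classical all_reals all_analysis.
From mathcomp Require Import lra.

Import Order.TTheory GRing.Theory Num.Theory.

Local Open Scope classical_set_scope.
Local Open Scope ring_scope.

Section prohorov_general.
Context {R : realType} {X : pointedMetricType R}.

Lemma sub_thickening (A : set X) (e : R) :
  0 < e -> A `<=` thickening A e.
Proof.
move=> e0 x Ax; apply: le_lt_trans (_ : (0 < e%:E)%E) => //.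
by apply: ereal_inf_lbound; exists x => //; rewrite mdistxx.
Qed.

Lemma prohorov_le (mu nu : probM X) (e : R) :
  0 < e -> prohorov_bound mu nu e -> prohorov mu nu <= e.
Proof. by move=> e0 b; apply: ge_inf => //; exists 0 => r [/ltW]. Qed.

End prohorov_general.

(* An alias is needed because the balls of negative radius of the library's
   discrete pseudometric on [bool] are nonempty, so it comes from no metric. *)
Definition two_points (R : realType) : Type := bool.

HB.instance Definition _ (R : realType) := Choice.copy (two_points R) bool.
HB.instance Definition _ (R : realType) :=
  isPointed.Build (two_points R) false.

Section two_points.
Context {R : realType}.
Implicit Types x y z : two_points R.

Definition two_dist x y : R := (x != y)%:R.

Lemma two_distxx x : two_dist x x = 0.
Proof. by rewrite /two_dist eqxx. Qed.

Lemma two_dist_positivity x y : two_dist x y = 0 -> x = y.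
Proof.
by rewrite /two_dist; case: eqVneq => //= _ /eqP; rewrite oner_eq0.
Qed.

Lemma two_dist_sym x y : two_dist x y = two_dist y x.
Proof. by rewrite /two_dist eq_sym. Qed.

Lemma two_dist_triangle y x z : two_dist x z <= two_dist x y + two_dist y z.
Proof. by rewrite /two_dist -natrD ler_nat; case: x y z => [] [] []. Qed.

HB.instance Definition _ := isMetric.Build R (two_points R)
  two_distxx two_dist_positivity two_dist_sym two_dist_triangle.

Lemma mdist_lt1 x y : mdist x y < 1 -> x = y.
Proof.
rewrite [mdist x y]/(two_dist x y) /two_dist.
by case: eqVneq => //=; rewrite ltxx.
Qed.

Lemma two_points_compact : compact [set: two_points R].
Proof.
rewrite -[X in compact X]/[set: bool] setT_bool.
by apply: (@compactU (two_points R)); exact: compact_set1.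
Qed.

(** The unit ball around a point contains that point only. This makes every subset Borel. *)
Lemma two_points_open (A : set (two_points R)) : open A.
Proof.
rewrite openE => x Ax; apply/nbhs_ballP; exists 1 => //= y.
by rewrite ballEmdist /= => /mdist_lt1 <-.
Qed.

Lemma shadowing_two_points : shadowing_property (@mdist R (two_points R)) id.
Proof.
move=> eps eps0; exists 1 => // len x xP; exists (x 0%N).
have iterE n : iter n id (x 0%N) = x 0%N by elim: n.
move=> n; rewrite iterE => nlen; suff <- : x 0%N = x n by rewrite mdistxx.
elim: n nlen => // n IHn nlen; have /mdist_lt1 <- := xP n nlen.
(* The induction descends along the orbit: if [n.+1] is an index of it, so is [n]. *)
by apply: IHn; case: len nlen {xP} => //= N /ltnW.
Qed.

Lemma two_points_thickening (A : set (two_points R)) (e : R) :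
  e <= 1 -> thickening A e `<=` A.
Proof.
move=> e1 x /ereal_inf_lt [_ [a Aa <-]].
by rewrite lte_fin => /lt_le_trans/(_ e1)/mdist_lt1 ->.
Qed.

Lemma two_points_measurable (A : set (borel (two_points R))) : measurable A.
Proof. by apply: sub_sigma_algebra; exact: two_points_open. Qed.

(** Thickening by a radius at most 1 adds no point, so a small Prohorov distance compares the two
    masses of the same set. The inequality is strict because some admissible radius [r] lies
    strictly below [e]. *)
Lemma prohorov_lt (mu nu : probM (two_points R)) (A : set (two_points R))
    (e : R) : e <= 1 -> prohorov mu nu < e -> (mu A < nu A + e%:E)%E.
Proof.
move=> e1 /(inf_lt (prohorov_has_inf mu nu).1) [r [_ b] re].
have [/le_lt_trans + _] := b A (two_points_measurable A); apply.
apply: (@le_lt_trans _ _ (nu A + r%:E)%E).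
  rewrite leeD2r// le_measure// ?inE; try exact: two_points_measurable.
  by apply: two_points_thickening; rewrite (le_trans (ltW re)).
by rewrite lteD2lE// ?lte_fin// fin_num_measure//; exact: two_points_measurable.
Qed.

Lemma of_bool_measurable :
  measurable_fun [set: bool] (id : bool -> borel (two_points R)).
Proof. by []. Qed.

(** Pushing forward along the identity carries the Bernoulli law from the sigma-algebra of [bool] to
    the Borel sets of [two_points R]. *)
Definition two_points_bernoulli (p : R) : probM (two_points R) :=
  distribution (bernoulli_prob p) (mfun_Sub (mem_set of_bool_measurable)).

Lemma two_points_bernoulliE (p : R) (A : set (two_points R)) : 0 <= p <= 1 ->
  two_points_bernoulli p A =
    (p * \1_A (true : two_points R) + (1 - p) * \1_A (false : two_points R))%:E.
Proof.
move=> p01; rewrite -[LHS]/(bernoulli_prob p (A : set bool)).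
by rewrite bernoulli_probE// !diracE !indicE -!EFinM -EFinD.
Qed.

(** On each set the two masses differ by 0 or by |p - q|, so this number is an admissible radius
    even before the set is thickened; [p != q] makes it positive, as the infimum demands. *)
Lemma prohorov_bernoulli (p q : R) : 0 <= p <= 1 -> 0 <= q <= 1 -> p != q ->
  prohorov (two_points_bernoulli p) (two_points_bernoulli q) <= `|p - q|.
Proof.
move=> p01 q01 pq; have : 0 < `|p - q| by rewrite normr_gt0 subr_eq0.
have lepq : p - q <= `|p - q| by exact: ler_norm.
have leqp : q - p <= `|p - q| by rewrite distrC ler_norm.
(* Only two linear bounds on |p - q| are kept, in the form that [lra] uses in each of the four cases
   for [A]. *)
move: `|p - q| lepq leqp => e lepq leqp e0.
apply: prohorov_le => // A mA.
have le_thick (mu : probM (two_points R)) :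
    (mu A + e%:E <= mu (thickening A e) + e%:E)%E.
  rewrite leeD2r// le_measure// ?inE; try exact: two_points_measurable.
  exact: sub_thickening.
split; apply: le_trans (le_thick _); rewrite !two_points_bernoulliE//;
  by rewrite -EFinD lee_fin !indicE; do 2 case: (_ \in A) => /=; lra.
Qed.

Lemma not_shadowing_two_points (c : continuous (@id (two_points R))) :
  ~ shadowing_property prohorov (induced_map c).
Proof.
have half0 : 0 < 2^-1 :> R by rewrite invr_gt0.
move=> /(_ _ half0) [delta delta0 shad].
(* [N] is chosen with 1/(N+1) < [delta]; then [n] = N+1 steps of length 1/n lead from the Dirac mass
   at [false] to the one at [true]. *)
have [N _ /(_ N (leqnn N)) Ndelta] := near_infty_natSinv_lt (PosNum delta0).
pose n := N.+1; have nR0 : 0 < n%:R :> R by rewrite ltr0n.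
pose x (k : nat) := two_points_bernoulli (k%:R / n%:R).
have kn01 (k : nat) : (k <= n)%N -> 0 <= (k%:R / n%:R : R) <= 1.
  by move=> kn; rewrite divr_ge0//= ler_pdivrMr// mul1r ler_nat.
have [k kn|mu mux] := shad (Some n) x.
  apply: le_lt_trans Ndelta.
  have -> : N.+1%:R^-1 = `|k%:R / n%:R - k.+1%:R / n%:R| :> R.
    by rewrite distrC -mulrBl -natrB// subSnn mul1r gtr0_norm// invr_gt0.
  apply: prohorov_bernoulli; [exact/kn01/ltnW|exact: kn01|].
  rewrite (inj_eq (mulIf _)) ?eqr_nat ?ltn_eqF//.
  by rewrite invr_eq0 gt_eqF.
(* The iterates of [mu] are compared with [mu] through their values on sets, since preimages under
   the identity change nothing. *)
have iterE k A : iter k (induced_map c) mu A = mu A.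
  by elim: k => //= k IHk; rewrite induced_mapE.
have half1 : 2^-1 <= 1 :> R by rewrite invf_le1// ler1n.
(* The measure at time 0 gives no mass to [true] and the one at time [n] gives none to [false]. A
   shadowing [mu] would thus have mass below 1/2 at both points, hence total mass below 1. *)
have := prohorov_lt _ _ [set true : two_points R] _ half1 (mux 0%N isT).
have := prohorov_lt _ _ [set false : two_points R] _ half1 (mux n (leqnn n)).
rewrite !iterE /x !two_points_bernoulliE ?kn01// !indicE.
rewrite divff ?gt_eqF// subrr !mul0r addr0 add0r !memNset// !mulr0 !add0e.
move=> muf mut; have := lteD mut muf.
rewrite -measureU//; try exact: two_points_measurable.
- have -> : [set true] `|` [set false] = [set: borel (two_points R)].
    by rewrite -[RHS]/[set: bool] setT_bool.
  by rewrite [ltLHS](probability_setT mu) -EFinD -div1r -splitr ltxx.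
- by apply/seteqP; split => // y [/= ->].
Qed.

End two_points.

Theorem theorem3p10 (R : realType) :
  exists (X : pointedMetricType R) (f : X -> X) (cf : continuous f),
    compact [set: X] /\
    shadowing_property mdist f /\
    ~ shadowing_property prohorov (induced_map cf).
Proof.
exists (two_points R), id, (fun x => cvg_id); split; last split.
- exact: two_points_compact.
- exact: shadowing_two_points.
- exact: not_shadowing_two_points.
Qed.
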